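(* Fix a positive integer $r \ge 2$ and let $c_r = \dfrac{r}{2(r!)^{1/r}}$. For any surjective $k$-colouring $\Delta:\mathbb{N}^{(r)}\to[k]$ and any natural number $m \le k$, there exists an $\hat m \in \mathcal{F}_\Delta$ such that \[|m-\hat m| \le c_r m^{1-1/r} + O(m^{1-2/r}),\] where the constant implied by the $O$-notation depends only on $r$.
   Context: Natural numbers are positive integers, $\mathbb{N}=\{1,2,\dots\}$, and $[k]=\{1,\dots,k\}$. For a set $X$, $X^{(r)}$ denotes the family of all subsets of $X$ of cardinality $r$ (the edges of the complete $r$-uniform hypergraph on $X$). A $k$-colouring is a surjective map $\Delta:\mathbb{N}^{(r)}\to[k]$. For $X\subset\mathbb{N}$, let $\gamma_\Delta(X)=|\Delta(X^{(r)})|$ be the number of colours appearing on $r$-subsets of $X$. Define $\mathcal{F}_\Delta=\{\gamma_\Delta(X): X\subset\mathbb{N},\ X \text{ infinite}\}$. *)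

(* Defs.v *)
From mathcomp Require Import all_boot all_order all_algebra finmap.
From mathcomp Require Import all_classical all_reals all_analysis.
Set Implicit Arguments.
Unset Strict Implicit.
Unset Printing Implicit Defensive.
Import Order.TTheory GRing.Theory Num.Theory.

Local Open Scope classical_set_scope.
Local Open Scope ring_scope.

(* The natural numbers start at 1 here. *)
Definition posnats : set nat := [set n | (0 < n)%N].

(* [k] = {1, ..., k} *)
Definition interval1 (k : nat) : set nat := [set i | (1 <= i <= k)%N].

(* X^(r) *)
Definition rsubsets (r : nat) (X : set nat) : set {fset nat} :=
  [set A | [set` A] `<=` X /\ #|` A|%fset = r].

(* A surjection from the r-subsets of the positive integers onto [k]. It is
   given by a total function on finite sets, whose values on sets that are not
   in the intended domain are never used. *)
Definition colouring (r k : nat) (Delta : {fset nat} -> nat) : Prop :=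
  Delta @` rsubsets r posnats = interval1 k.

(* fset_set returns the empty set on infinite sets; for a colouring and a set X
   of positive integers the image is contained in [k], hence finite. *)
Definition gamma (r : nat) (Delta : {fset nat} -> nat) (X : set nat) : nat :=
  #|` fset_set (Delta @` rsubsets r X)|%fset.

Definition colour_counts (r : nat) (Delta : {fset nat} -> nat) : set nat :=
  [set gamma r Delta X | X in [set X | X `<=` posnats /\ infinite_set X]].

Definition cr (R : realType) (r : nat) : R :=
  r%:R / (2 * (r`!)%:R `^ (r%:R^-1)).

(* Main.v *)
Require Import Defs.
From mathcomp Require Import all_boot all_order all_algebra finmap.
From mathcomp Require Import all_classical all_reals all_analysis.
From mathcomp Require Import zify lra.

(** Ramsey's theorem makes the problem finite. Choose a finite [F] carrying an
    edge of every colour, then shrink the rest of the positive integers to an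
    infinite [M] such that, for every [e] contained in [F] with at most [r]
    elements, all edges [e `|` A] with [A] contained in [M] have one colour
    [c e] ([homogeneous_links]). For [G] contained in [F], the colours seen on
    [G `|` M] are then exactly the values of [c] on the at most [r]-element
    subsets of [G], the palette of [G] ([gamma_palette]), so the size of every
    such palette is an attained colour count ([finite_reduction]).

    Take [G] minimal among the subsets of [F] whose palette has at least [m]
    elements, and let [n] be its size and [p] the size of its palette. Removing
    any vertex brings the count below [m], so if some vertex costs only [g]
    colours, then one of the two counts [p] and [p - g] is within [g / 2] of
    [m]. A colour is lost with [v] only if [v] belongs to every subset carrying
    that colour; fixing one such subset per colour, each colour is charged to
    at most [r] vertices, so some vertex costs [g <= r * p / n]
    ([cheap_vertex]). On the other hand [p] is at most the number of subsets of
    size at most [r], whence [r! * p <= (n + r) ^ r] ([card_palette_le]) and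
    [n] is at least about [(r! * m) ^ (1 / r)]. Since [p <= m + g], the loss [g]
    is at most [2 * c_r * m ^ (1 - 1 / r)] up to lower order
    ([gap_estimate]). *)

Set Implicit Arguments.
Unset Strict Implicit.
Import Order.TTheory GRing.Theory Num.Theory.

Local Open Scope classical_set_scope.
Local Open Scope ring_scope.

(** * Ramsey's theorem for r-uniform hypergraphs *)

Lemma rsubsetsS (r : nat) (X Y : set nat) :
  X `<=` Y -> rsubsets r X `<=` rsubsets r Y.
Proof. by move=> XY A [AX cA]; split=> // y /AX /XY. Qed.

Lemma rsubsets_nonempty (r : nat) (X : set nat) :
  infinite_set X -> exists A, rsubsets r X A.
Proof.
move=> infX; have [B BX rB] := infinite_set_fset r infX.
exists [fset x in take r (enum_fset B)]%fset; split.
  by move=> x /=; rewrite !inE => /mem_take /BX.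
by rewrite card_fseq undup_id ?size_takel // take_uniq // fset_uniq.
Qed.

(** One round of the Erdos-Rado construction: fixing a vertex [x] turns [f] into
    a colouring of [r]-sets, so the case [r] yields an infinite tail on which the
    colour of an [r.+1]-set starting at [x] does not depend on the rest. The
    witness is packed as a triple (vertex, colour, tail) so that the step can be
    turned into a function and iterated. *)
Lemma ramsey_step (T : Type) (r : nat)
    (IH : forall (f : {fset nat} -> T) (X : set nat), infinite_set X ->
       finite_set (f @` rsubsets r X) ->
       exists Y : set nat, [/\ Y `<=` X, infinite_set Y &
         exists c, forall A, rsubsets r Y A -> f A = c])
    (f : {fset nat} -> T) (X : set nat) :
  infinite_set X -> finite_set (f @` rsubsets r.+1 X) ->
  exists p : nat * T * set nat,
    [/\ X p.1.1, p.2 `<=` X, infinite_set p.2,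
        forall y, p.2 y -> (p.1.1 < y)%N &
        forall A, rsubsets r p.2 A -> f (p.1.1 |` A)%fset = p.1.2].
Proof.
move=> infX finf; have [x Xx] := infinite_setN0 infX.
pose X1 := X `\` `I_x.+1.
have infX1 : infinite_set X1 by apply: infinite_setD => //; exact: finite_II.
have X1x y : X1 y -> X y /\ (x < y)%N.
  by move=> [Xy /negP]; rewrite -leqNgt.
have [|Y [YX1 infY [c Yc]]] := IH (fun A => f (x |` A)%fset) X1 infX1.
  apply: sub_finite_set finf => _ [A [AX1 cA] <-].
  exists (x |` A)%fset => //; split.
    by move=> y /=; rewrite in_fset1U => /orP[/eqP-> //|/AX1 /X1x []].
  rewrite cardfsU1 cA; case: (boolP (x \in A)) => //= /AX1 /X1x [_].
  by rewrite ltnn.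
exists (x, c, Y); split => //= y /YX1 /X1x [] //.
Qed.

(** Iterating the step gives an increasing sequence in which the colour of an
    edge depends only on its least vertex; the pigeonhole principle then selects
    a subsequence on which this colour is constant. *)
Lemma infinite_ramsey (T : Type) (r : nat) (f : {fset nat} -> T)
    (X : set nat) :
  infinite_set X -> finite_set (f @` rsubsets r X) ->
  exists Y : set nat, [/\ Y `<=` X, infinite_set Y &
    exists c, forall A, rsubsets r Y A -> f A = c].
Proof.
elim: r f X => [|r IH] f X infX finf.
  exists X; split=> //; exists (f fset0) => A [_ cA].
  by rewrite (cardfs0_eq cA).
(* The value on sets that are not infinite subsets of X is arbitrary. *)
have /choice[s sP] : forall Z : set nat, exists p : nat * T * set nat,
    infinite_set Z -> Z `<=` X ->
    [/\ Z p.1.1, p.2 `<=` Z, infinite_set p.2,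
        forall y, p.2 y -> (p.1.1 < y)%N &
        forall A, rsubsets r p.2 A -> f (p.1.1 |` A)%fset = p.1.2].
  move=> Z; have [[infZ ZX]|nZ] := pselect (infinite_set Z /\ Z `<=` X).
    have [|p pP] := ramsey_step IH (f := f) infZ; last by exists p.
    by apply: sub_finite_set finf; apply: image_subset; apply: rsubsetsS.
  have [A _] := rsubsets_nonempty 0 infX.
  by exists (0%N, f A, Z) => infZ ZX; case: nZ.
pose Xs n := iter n (fun Z => (s Z).2) X.
pose x n := (s (Xs n)).1.1.
pose c n := (s (Xs n)).1.2.
have XsP n : infinite_set (Xs n) /\ Xs n `<=` X.
  elim: n => [|n [infn nX]]; first by split.
  have [_ sub inf _ _] := sP _ infn nX.
  by split=> // y /sub /nX.
have step n : [/\ Xs n (x n), Xs n.+1 `<=` Xs n,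
    forall y, Xs n.+1 y -> (x n < y)%N &
    forall A, rsubsets r (Xs n.+1) A -> f (x n |` A)%fset = c n].
  by have [inf sub] := XsP n; have [] := sP _ inf sub.
have Xs_anti i j : (i <= j)%N -> Xs j `<=` Xs i.
  elim: j => [|j IHj]; first by rewrite leqn0 => /eqP->.
  rewrite leq_eqVlt => /orP[/eqP-> //|/IHj sub] y Xy; apply: sub.
  by have [_ + _ _] := step j; apply.
have x_tail i j : (i < j)%N -> Xs i.+1 (x j).
  by move=> /Xs_anti; apply; have [] := step j.
have x_mono i j : (i < j)%N -> (x i < x j)%N.
  by move=> /x_tail; have [_ _ + _] := step i; apply.
have x_inj : injective x.
  move=> i j xij; case: (ltngtP i j) => // /x_mono; rewrite xij ltnn //.
have finc : finite_set (range c).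
  apply: sub_finite_set finf => _ [n _ <-].
  have [infn1 subn1] := XsP n.+1; have [_ _ gt fc] := step n.
  have [A rA] := rsubsets_nonempty r infn1.
  exists (x n |` A)%fset; last exact: fc.
  have [AX cA] := rA; split.
    move=> y /=; rewrite in_fset1U => /orP[/eqP->|/AX /subn1 //].
    by have [+ _ _ _] := step n; have [_ +] := XsP n => /[apply].
  rewrite cardfsU1 cA; case: (boolP (x n \in A)) => //= /AX /gt.
  by rewrite ltnn.
have [c0 [N infN cN]] := finite_range_cst_subsequence finc.
exists (x @` N); split.
- move=> _ [n _ <-]; have [+ _ _ _] := step n; have [_ +] := XsP n; exact.
- move=> finxN; apply: infN.
  have : finite_set (x @^-1` (x @` N)).
    by apply: finite_preimage finxN => i j _ _ /x_inj.
  by apply: sub_finite_set => n Nn; exists n.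
exists c0 => A [AN cA].
(* The least element of A decides its colour. *)
have exA : exists b, b \in A.
  by apply/fset0Pn; rewrite -cardfs_gt0 cA.
have [a aA amin] : exists2 a, a \in A & forall y, y \in A -> (a <= y)%N.
  by case: (ex_minnP exA) => a; exists a.
have [n Nn xna] := AN _ aA.
have An y : y \in (A `\ a)%fset -> Xs n.+1 y.
  rewrite !inE => /andP[ya yA]; have [j _ xjy] := AN _ yA.
  rewrite -xjy; apply: x_tail; rewrite ltnNge; apply/negP => jn.
  move: ya; rewrite -xjy -xna.
  move: jn; rewrite leq_eqVlt => /orP[/eqP->|/x_mono]; first by rewrite eqxx.
  by rewrite xjy xna ltnNge amin.
have [_ _ _ fc] := step n.
rewrite -(cN n).1 // -(fc (A `\ a)%fset).
  by rewrite xna fsetD1K.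
split; first by move=> y /An.
by move: cA; rewrite (cardfsD1 a) aA => -[].
Qed.

(** * Palettes of finite vertex sets *)

Definition small_subsets (V : choiceType) (r : nat) (G : {fset V}) :
  {fset {fset V}} := [fset e in fpowerset G | (#|` e| <= r)%N]%fset.

Definition palette (V T : choiceType) (r : nat) (c : {fset V} -> T)
  (G : {fset V}) : {fset T} := (c @` small_subsets r G)%fset.

Lemma small_subsetsP (V : choiceType) (r : nat) (G e : {fset V}) :
  (e \in small_subsets r G) = (e `<=` G)%fset && (#|` e| <= r)%N.
Proof. by rewrite !inE /= fpowersetE. Qed.

Lemma palette_sub (V T : choiceType) (r : nat) (c : {fset V} -> T)
    (G H : {fset V}) :
  (G `<=` H)%fset -> (palette r c G `<=` palette r c H)%fset.
Proof.
move=> GH; apply/fsubsetP => _ /imfsetP[e /= + ->].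
rewrite small_subsetsP => /andP[eG er]; apply: in_imfset.
by rewrite /= small_subsetsP (fsubset_trans eG GH).
Qed.

Lemma card_palette0 (V T : choiceType) (r : nat) (c : {fset V} -> T) :
  #|` palette r c fset0| = 1%N.
Proof.
apply/eqP/cardfs1P; exists (c fset0); apply/fsetP => t; rewrite inE.
apply/imfsetP/eqP => [[e /=]|->].
  by rewrite small_subsetsP fsubset0 => /andP[/eqP-> _].
by exists fset0; rewrite //= small_subsetsP fsub0set cardfs0.
Qed.

(** By Pascal's rule: a subset of [x |` G] either avoids [x] or is [x] added to a
    subset of [G] with one element less. The exact number is a sum of [r.+1]
    binomial coefficients and differs from this bound only in lower order terms,
    which the error term of the theorem absorbs. *)
Lemma card_small_subsets (V : choiceType) (r : nat) (G : {fset V}) :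
  (#|` small_subsets r G| <= 'C(#|` G| + r, r))%N.
Proof.
elim/fset1U_rect: G r => [|x G xG IH] r.
  rewrite cardfs0 add0n binn -[X in (_ <= X)%N](cardfs1 (@fset0 V)).
  apply: fsubset_leq_card; apply/fsubsetP => e.
  by rewrite small_subsetsP fsubset0 inE => /andP[].
case: r => [|r].
  rewrite bin0 -[X in (_ <= X)%N](cardfs1 (@fset0 V)).
  apply: fsubset_leq_card; apply/fsubsetP => e.
  by rewrite small_subsetsP leqn0 cardfs_eq0 inE => /andP[].
rewrite cardfsU1 xG add1n addSn addnS binS -addnS.
have sub : (small_subsets r.+1 (x |` G) `<=` small_subsets r.+1 G `|`
    [fset (x |` e)%fset | e in small_subsets r G])%fset.
  apply/fsubsetP => e; rewrite inE !small_subsetsP => /andP[exG er].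
  apply/orP; have [xe|xe] := boolP (x \in e); last first.
    left; rewrite er andbT; apply/fsubsetP => y ye.
    have := fsubsetP exG y ye; rewrite in_fset1U => /orP[/eqP yx|//].
    by rewrite yx (negPf xe) in ye.
  right; apply/imfsetP; exists (e `\ x)%fset => /=; last by rewrite fsetD1K.
  rewrite small_subsetsP; move: er; rewrite (cardfsD1 x) xe ltnS => ->.
  by rewrite andbT fsubDset.
apply: leq_trans (fsubset_leq_card sub) _.
apply: leq_trans (leq_card_fsetU _ _).1 _.
rewrite leq_add ?IH //.
apply: leq_trans (leq_imfset_card _ _ _) _.
by apply: leq_trans (IH r) _; apply: leq_bin2l; rewrite leq_add2l.
Qed.

Lemma ffact_le_expn (n m : nat) : (n ^_ m <= n ^ m)%N.
Proof.
elim: m n => [|m IH] n; first by rewrite ffactn0.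
rewrite ffactnS expnS leq_mul2l; apply/orP; right.
apply: leq_trans (IH _) _; case: m {IH} => // m.
by rewrite leq_exp2r ?leq_pred.
Qed.

Lemma card_palette_le (V T : choiceType) (r : nat) (c : {fset V} -> T)
    (G : {fset V}) :
  (r`! * #|` palette r c G| <= (#|` G| + r) ^ r)%N.
Proof.
apply: leq_trans (ffact_le_expn _ _); rewrite -bin_ffact mulnC leq_mul2r.
apply/orP; right; apply: leq_trans (leq_imfset_card _ _ _) _.
exact: card_small_subsets.
Qed.

(** Double counting: fix for each colour [t] one subset [e t] of colour [t]. If
    [t] disappears with [v], then [v] lies in [e t], which has at most [r]
    elements. *)
Lemma sum_lost_colours (V T : choiceType) (r : nat) (c : {fset V} -> T)
    (G : {fset V}) :
  (\sum_(v <- G) #|` (palette r c G `\` palette r c (G `\ v))%fset|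
     <= r * #|` palette r c G|)%N.
Proof.
have /choice[e eP] : forall t : T, exists e : {fset V},
    t \in palette r c G -> [/\ c e = t, (e `<=` G)%fset & (#|` e| <= r)%N].
  move=> t; have [/imfsetP[e /= + ->]|] := boolP (t \in palette r c G).
    by rewrite small_subsetsP => /andP[eG er]; exists e.
  by exists fset0.
have lost v : v \in G -> (#|` (palette r c G `\` palette r c (G `\ v))%fset| <=
    \sum_(t <- palette r c G) (v \in e t))%N.
  move=> vG; rewrite -big_mkcond /=.
  rewrite [X in (_ <= X)%N]big_fset_condE -card_fset_sum1.
  apply: fsubset_leq_card; apply/fsubsetP => t.
  rewrite !inE => /andP[tn tG]; rewrite tG /=; apply: contraNT tn => vet.
  have [ct eG er] := eP _ tG; rewrite -ct; apply: in_imfset; rewrite /= small_subsetsP er.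
  by rewrite fsubsetD1 eG vet.
apply: (@leq_trans (\sum_(v <- G) \sum_(t <- palette r c G) (v \in e t))%N).
  by rewrite big_seq [X in (_ <= X)%N]big_seq; apply: leq_sum.
rewrite exchange_big /= mulnC card_fset_sum1 big_distrl /=.
rewrite big_seq [X in (_ <= X)%N]big_seq; apply: leq_sum => t /eP[_ eG er].
rewrite mul1n; apply: leq_trans er; rewrite -big_mkcond /= big_fset_condE.
rewrite -card_fset_sum1; apply: fsubset_leq_card; apply/fsubsetP => v.
by rewrite !inE => /andP[].
Qed.

(** A vertex of least loss does no worse than the average. *)
Lemma cheap_vertex (V T : choiceType) (r : nat) (c : {fset V} -> T)
    (G : {fset V}) :
  G != fset0 -> exists2 v, v \in G &
    (#|` G| * (#|` palette r c G| - #|` palette r c (G `\ v)%fset|)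
       <= r * #|` palette r c G|)%N.
Proof.
move=> /fset0Pn G0.
pose lost v := (#|` palette r c G| - #|` palette r c (G `\ v)%fset|)%N.
have [v vG vmin] : exists2 v, v \in G &
    forall w, w \in G -> (lost v <= lost w)%N.
  have exl : exists l, [exists v : G, lost (val v) == l].
    by have [v vG] := G0; exists (lost v); apply/existsP; exists [` vG]%fset.
  case: (ex_minnP exl) => l /existsP[v /eqP <-] lmin.
  exists (val v) => [|w wG]; first exact: valP.
  by apply: lmin; apply/existsP; exists [` wG]%fset.
exists v => //; apply: leq_trans (sum_lost_colours r c G).
rewrite card_fset_sum1 big_distrl /= big_seq [X in (_ <= X)%N]big_seq.
apply: leq_sum => w wG; rewrite mul1n cardfsDS; first exact: vmin.
by apply: palette_sub; rewrite fsubsetDl.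
Qed.

Lemma minimal_palette (V T : choiceType) (r : nat) (c : {fset V} -> T)
    (F : {fset V}) (m : nat) :
  (m <= #|` palette r c F|)%N -> exists G, [/\ (G `<=` F)%fset,
    (m <= #|` palette r c G|)%N &
    forall v, v \in G -> (#|` palette r c (G `\ v)%fset| < m)%N].
Proof.
elim/finSet_rect: F => F IH mF.
have [|nF] := pselect (exists2 v, v \in F & (m <= #|` palette r c (F `\ v)%fset|)%N).
  move=> [v vF /(IH _ (fproperD1 vF))[G [GF mG Gmin]]].
  by exists G; split=> //; apply: fsubset_trans GF (fsubsetDl _ _).
exists F; split=> // v vF; rewrite ltnNge; apply/negP => mv.
by apply: nF; exists v.
Qed.

(** * Reduction to palettes *)

Lemma rsubsets_link (r : nat) (G e A : {fset nat}) (M : set nat) :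
  (forall x, M x -> x \notin G) -> (e `<=` G)%fset -> (#|` e| <= r)%N ->
  rsubsets (r - #|` e|) M A -> rsubsets r ([set` G] `|` M) (e `|` A)%fset.
Proof.
move=> MG eG er [AM cA]; split.
  by move=> x /=; rewrite in_fsetU => /orP[/(fsubsetP eG)|/AM]; [left|right].
rewrite cardfsU cA subnKC //; have -> : (e `&` A = fset0)%fset.
  apply/fsetP => x; rewrite !inE; apply/negP => /andP[/(fsubsetP eG) xG].
  by move=> /AM /MG; rewrite xG.
by rewrite cardfs0 subn0.
Qed.

(** Ramsey's theorem applied successively to the links of the finitely many sets
    [e] listed in [es]. *)
Lemma homogeneous_links (r : nat) (f : {fset nat} -> nat) (F : {fset nat})
    (es : seq {fset nat}) (X : set nat) :
  infinite_set X ->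
  finite_set (f @` rsubsets r ([set` F] `|` X)) ->
  (forall x, X x -> x \notin F) ->
  (forall e, e \in es -> (e `<=` F)%fset && (#|` e| <= r)%N) ->
  exists Y : set nat, [/\ Y `<=` X, infinite_set Y &
    forall e, e \in es -> exists t,
      forall A, rsubsets (r - #|` e|) Y A -> f (e `|` A)%fset = t].
Proof.
move=> infX finf XF; elim: es => [|e es IH] esF; first by exists X; split.
have [|Y [YX infY Yes]] := IH; first by move=> d des; rewrite esF // inE des orbT.
have /andP[eF er] : (e `<=` F)%fset && (#|` e| <= r)%N by rewrite esF ?mem_head.
have [|Z [ZY infZ [t Zt]]] :=
    infinite_ramsey (r := r - #|` e|) (f := fun A => f (e `|` A)%fset) infY.
  apply: sub_finite_set finf => _ [A AY <-]; exists (e `|` A)%fset => //.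
  by apply: rsubsets_link => //; exact: rsubsetsS AY.
exists Z; split=> [x /ZY /YX //|//|d]; rewrite inE => /orP[/eqP->|des].
  by exists t.
have [u Yu] := Yes d des; exists u => A /(rsubsetsS ZY); exact: Yu.
Qed.

(** An edge [A] of [G `|` M] has the colour of its trace on [G]; conversely, every
    small subset of [G] extends to an edge because [M] is infinite. *)
Lemma gamma_palette (r : nat) (f c : {fset nat} -> nat) (G : {fset nat})
    (M : set nat) :
  infinite_set M -> (forall x, M x -> x \notin G) ->
  (forall e, (e `<=` G)%fset -> (#|` e| <= r)%N ->
     forall A, rsubsets (r - #|` e|) M A -> f (e `|` A)%fset = c e) ->
  gamma r f ([set` G] `|` M) = #|` palette r c G|.
Proof.
move=> infM MG fc; rewrite /gamma -[palette r c G]set_fsetK; congr #|` fset_set _|.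
apply/seteqP; split=> [_ [A [AGM cA] <-]|t /= /imfsetP[e /=]].
  have AGM' x : x \in A -> x \notin G -> M x by move=> /AGM[/= ->|].
  rewrite -(fsetID G A) (fc (A `&` G)%fset).
  - apply: in_imfset; rewrite /= small_subsetsP fsubsetIr -cA.
    by apply: fsubset_leq_card; exact: fsubsetIl.
  - exact: fsubsetIr.
  - by rewrite -cA; apply: fsubset_leq_card; exact: fsubsetIl.
  split; first by move=> x /=; rewrite inE => /andP[xG xA]; exact: AGM'.
  by rewrite -cA cardfsD.
rewrite small_subsetsP => /andP[eG er] ->.
have [A AM] := rsubsets_nonempty (r - #|` e|) infM.
by exists (e `|` A)%fset; [exact: rsubsets_link|exact: fc].
Qed.

(** The set [F] is a union of edges, one of each colour; as these edges are
    subsets of [F] of size [r], their colours are already in its palette. *)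
Lemma finite_reduction (r k : nat) (Delta : {fset nat} -> nat) :
  colouring r k Delta ->
  exists (F : {fset nat}) (c : {fset nat} -> nat),
    (k <= #|` palette r c F|)%N /\
    forall G, (G `<=` F)%fset -> colour_counts r Delta #|` palette r c G|.
Proof.
move=> Dk.
have /choice[e eP] : forall i, exists e : {fset nat},
    interval1 k i -> rsubsets r posnats e /\ Delta e = i.
  move=> i; have [ik|] := pselect (interval1 k i); last by exists fset0.
  by have := ik; rewrite -Dk => -[A ? ?]; exists A.
pose F := (\bigcup_(i <- iota 1 k) e i)%fset.
have eF i : interval1 k i -> (e i `<=` F)%fset.
  move=> /= ik; apply: bigfcup_sup => //.
  by rewrite mem_iota add1n ltnS.
have Fpos x : x \in F -> (0 < x)%N.
  move=> /bigfcupP[i]; rewrite mem_iota add1n ltnS andbT => /eP[[+ _] _].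
  exact.
pose X := posnats `\` [set` F].
have infpos : infinite_set posnats.
  have -> : posnats = setT `\` [set 0%N].
    by apply/seteqP; split=> [[]|[|n] [_ //] /(_ erefl)].
  by apply: infinite_setD; [exact: infinite_nat|exact: finite_set1].
have infX : infinite_set X by apply: infinite_setD.
have XF x : X x -> x \notin F by move=> [_ /negP].
have Xpos : X `<=` posnats by move=> x [].
have FXpos : [set` F] `|` X `<=` posnats by move=> x [/Fpos|/Xpos].
have finD : finite_set (Delta @` rsubsets r ([set` F] `|` X)).
  apply: (@sub_finite_set _ _ (interval1 k)).
    by rewrite -Dk; apply: image_subset; apply: rsubsetsS.
  by apply: (@sub_finite_set _ _ `I_k.+1) => // i /andP[].
have [d|M [MX infM Mh]] := homogeneous_links infX finD XF
    (es := enum_fset (small_subsets r F)).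
  by rewrite small_subsetsP.
have /choice[c cP] : forall d : {fset nat}, exists t,
    (d `<=` F)%fset -> (#|` d| <= r)%N ->
    forall A, rsubsets (r - #|` d|) M A -> Delta (d `|` A)%fset = t.
  move=> d; have [dF|dF] := boolP (d \in small_subsets r F).
    by have [t Mt] := Mh d dF; exists t.
  by exists 0%N => dF' dr; rewrite small_subsetsP dF' dr in dF.
exists F, c; split.
  rewrite -[X in (X <= _)%N](size_iota 1) -(undup_id (iota_uniq 1 k)).
  rewrite -card_fseq; apply: fsubset_leq_card; apply/fsubsetP => i.
  rewrite !inE mem_iota add1n ltnS => ik.
  have [[_ ce] <-] := eP i ik; have := eF i ik => eiF.
  apply/imfsetP; exists (e i); first by rewrite /= small_subsetsP eiF ce /=.
  rewrite -[in LHS](fsetU0 (e i)); apply: cP; rewrite ?ce //.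
  by rewrite subnn; split; rewrite ?cardfs0 // => x; rewrite /= inE.
move=> G GF; exists ([set` G] `|` M).
  split; first by move=> x [/(fsubsetP GF) /Fpos|/MX /Xpos].
  by apply: sub_infinite_set infM => x; right.
apply: gamma_palette => //.
  by move=> x /MX /XF; apply: contraNN => /(fsubsetP GF).
by move=> d dG; apply: cP; exact: fsubset_trans dG GF.
Qed.

(** The combinatorial core, with [n] the number of vertices of a minimal [G] and
    [g] the loss at its cheapest vertex. The two counts around [m] differ by
    [g], so the nearer one is within [g / 2]. The bound [2 <= m] guarantees that
    [G] has a vertex to remove, the empty set having a palette of one colour. *)
Lemma near_miss (r k : nat) (Delta : {fset nat} -> nat) (m : nat) :
  colouring r k Delta -> (2 <= m)%N -> (m <= k)%N ->
  exists n g mhat : nat, [/\ colour_counts r Delta mhat,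
    (2 * m <= 2 * mhat + g)%N, (2 * mhat <= 2 * m + g)%N,
    (n * g <= r * (m + g))%N & (r`! * m <= (n + r) ^ r)%N].
Proof.
move=> /finite_reduction[F [c [kF FG]]] m2 mk.
have [G [GF mG Gmin]] := minimal_palette (leq_trans mk kF).
have G0 : G != fset0.
  by apply/eqP => G0; move: mG; rewrite G0 card_palette0 leqNgt m2.
have [v vG] := cheap_vertex r c G0.
have aF := FG _ GF.
have bF := FG _ (fsubset_trans (fsubsetDl G [fset v]%fset) GF).
move: (card_palette_le r c G) aF bF mG (Gmin v vG).
set a := #|` palette r c G|; set b := #|` palette r c (G `\ v)%fset|.
move=> afact aF bF ma bm gle.
have gm : (#|` G| * (a - b) <= r * (m + (a - b)))%N.
  by apply: leq_trans gle _; rewrite leq_mul2l; lia.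
have mfact : (r`! * m <= (#|` G| + r) ^ r)%N.
  by apply: leq_trans afact; rewrite leq_mul2l ma orbT.
have [near_a|near_b] := leqP (2 * (a - m)) (a - b).
  by exists #|` G|, (a - b)%N, a; split=> //; lia.
by exists #|` G|, (a - b)%N, b; split=> //; lia.
Qed.

Lemma colour_counts1 (r k : nat) (Delta : {fset nat} -> nat) :
  colouring r k Delta -> colour_counts r Delta 1%N.
Proof.
move=> /finite_reduction[F [c [_ FG]]].
by rewrite -(card_palette0 r c); apply: FG; exact: fsub0set.
Qed.

(** * The asymptotic estimate *)

(** From [n * g <= r * (m + g)] and [n >= s - r] follows
    [g <= r * m / (s - 2 * r)]; and [1 / (s - 2 * r)] is at most
    [(1 + 4 * r / s) / s] as soon as [s >= 4 * r]. Used with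
    [s = (r! * m) ^ (1 / r)], the first summand is the main term and the second
    has order [m ^ (1 - 2 / r)]. *)
Lemma gap_estimate (R : realFieldType) (r m s n g : R) :
  0 < r -> 0 <= m -> 4 * r <= s -> s <= n + r -> 0 <= g ->
  n * g <= r * (m + g) ->
  g / 2 <= r * m / (2 * s) + 2 * r ^+ 2 * m / s ^+ 2.
Proof.
move=> r0 m0 rs sn g0 ng.
have s0 : 0 < s by lra.
have s2r : 0 < s - 2 * r by lra.
have gs : g * (s - 2 * r) <= r * m by nra.
have -> : r * m / (2 * s) + 2 * r ^+ 2 * m / s ^+ 2 =
    r * m * (s + 4 * r) / s ^+ 2 / 2.
  rewrite invfM -exprVn; have su : s * s^-1 = 1 by rewrite mulfV ?gt_eqF.
  have se : (s + 4 * r) * s^-1 ^+ 2 = s^-1 + 4 * r * s^-1 ^+ 2.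
    by rewrite mulrDl expr2 !mulrA su mul1r.
  by rewrite -[X in X / 2]mulrA se; lra.
rewrite ler_pM2r // ler_pdivlMr ?exprn_gt0 //.
rewrite -(ler_pM2r s2r).
apply: (@le_trans _ _ (r * m * s ^+ 2)).
  by rewrite mulrAC ler_wpM2r // exprn_ge0 // ltW.
rewrite -!mulrA !ler_wpM2l ?(ltW r0) //.
nra.
Qed.

Unset Implicit Arguments.

Theorem theorem1p1 (R : realType) (r : nat) (hr : (2 <= r)%N) :
  exists C : R,
    forall (k : nat) (Delta : {fset nat} -> nat), colouring r k Delta ->
    forall m : nat, (1 <= m)%N -> (m <= k)%N ->
    exists2 mhat : nat, colour_counts r Delta mhat &
      `|m%:R - mhat%:R| <=
        cr R r * m%:R `^ (1 - 1 / r%:R) + C * m%:R `^ (1 - 2 / r%:R).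
Proof.
pose a : R := (r`!)%:R `^ (r%:R^-1).
have r0 : 0 < r%:R :> R by rewrite ltr0n; lia.
have a0 : 0 < a by rewrite powR_gt0 // ltr0n fact_gt0.
(* 18 = 16 + 2: the summand 16 covers the bounded range s < 4 r, where m-hat = 1
   will do, and 2 is the constant of the error term of gap_estimate. *)
exists (18 * r%:R ^+ 2 / a ^+ 2) => k Delta Dk m m1 mk.
have m0 : 0 < m%:R :> R by rewrite ltr0n.
pose mu : R := m%:R `^ (r%:R^-1).
have mu0 : 0 < mu by rewrite powR_gt0.
have -> : m%:R `^ (1 - 1 / r%:R) = m%:R / mu.
  rewrite powRD; last by rewrite (gt_eqF m0) implybT.
  by rewrite powRr1 ?(ltW m0) // powRN div1r.
have -> : m%:R `^ (1 - 2 / r%:R) = m%:R / mu ^+ 2.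
  rewrite powRD; last by rewrite (gt_eqF m0) implybT.
  by rewrite powRr1 ?(ltW m0) // powRN -powR_mulrn ?powR_ge0 //
    -powRrM [_^-1 * _]mulrC.
have -> : cr R r * (m%:R / mu) = r%:R * m%:R / (2 * (a * mu)).
  by rewrite /cr -/a mulf_div [2 * (a * mu)]mulrA.
have -> : 18 * r%:R ^+ 2 / a ^+ 2 * (m%:R / mu ^+ 2) =
    18 * r%:R ^+ 2 * m%:R / (a * mu) ^+ 2.
  by rewrite mulf_div exprMn.
have s0 : 0 < a * mu by rewrite mulr_gt0.
set s := a * mu in s0 *.
have main0 : 0 <= r%:R * m%:R / (2 * s).
  by rewrite divr_ge0 ?mulr_ge0 // ltW.
have err0 : 0 <= r%:R ^+ 2 * m%:R / s ^+ 2.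
  by rewrite divr_ge0 ?mulr_ge0 ?exprn_ge0 // ltW.
(* Here m <= (4 r / a)^2 * m / mu^2, so the error term alone exceeds m. *)
have [s_small|s_large] := ltP s (4 * r%:R).
  exists 1%N; first exact: colour_counts1 Dk.
  rewrite ger0_norm ?subr_ge0 ?ler1n //.
  have : m%:R <= 16 * (r%:R ^+ 2 * m%:R / s ^+ 2).
    rewrite mulrA ler_pdivlMr ?exprn_gt0 // mulrC mulrA ler_wpM2r //.
    nra.
  lra.
have [m_eq1|m2] : m = 1%N \/ (2 <= m)%N by lia.
  exists 1%N; first exact: colour_counts1 Dk.
  rewrite {1}m_eq1 subrr normr0; lra.
have [n [g [mhat [Fmhat mle mge ng mfact]]]] := near_miss Dk m2 mk.
exists mhat => //.
have sn : s <= n%:R + r%:R.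
  have -> : n%:R + r%:R = ((n + r) ^ r)%N%:R `^ (r%:R^-1) :> R.
    rewrite natrX -powR_mulrn // -powRrM mulfV ?gt_eqF // powRr1 // natrD //.
  rewrite /s /a /mu -powRM // -natrM.
  by apply: ge0_ler_powR; rewrite ?nnegrE ?invr_ge0 ?ler_nat.
have gR : n%:R * g%:R <= r%:R * (m%:R + g%:R) :> R.
  by rewrite -natrD -!natrM ler_nat.
have est := gap_estimate r0 (ltW m0) s_large sn (ler0n _ g) gR.
have dist : `|m%:R - mhat%:R| <= g%:R / 2 :> R.
  have mleR : 2 * m%:R <= 2 * mhat%:R + g%:R :> R.
    by rewrite -!natrM -natrD ler_nat.
  have mgeR : 2 * mhat%:R <= 2 * m%:R + g%:R :> R.
    by rewrite -!natrM -natrD ler_nat.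
  by rewrite ler_norml; apply/andP; split; lra.
lra.
Qed.
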